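(* Let $N\ge1$, $\delta>0$, $\alpha>0$. Suppose each $c_n:\mathbb{R}\to\mathbb{R}$ ($n=1,\dots,N$) is continuous, satisfies $c_n(s)=0$ for $s\le 0$, is convex and strictly increasing on $[0,\infty)$, and satisfies $\frac{\partial^+c_n(0)}{\partial s_n}\ge\frac{\alpha}{2N}$. Suppose the social cost minimization problem has an optimal solution $(\mathbf{s}^*,y^* )$ with $y^*>0$. Let $(\mathbf{s}^a,y^a)$ be the allocation at the price-anticipating market equilibrium $(\mathbf{b}^a,p^a,y^a)$, where $s^a_n=S(b^a_n,p^a)$. Then $$\sum_n c_n(s_n^a)+\alpha y^a\ \le\ \sum_n c_n(s_n^* )+\alpha y^*+\frac{\alpha\delta}{N}.$$
   Context: There are $N$ tenants; $\delta$ is the total energy reduction target; $y$ is the amount of on-site generation, with unit cost $\alpha$. $\partial^+$ denotes right derivative. The social cost minimization problem is $$\min\ \alpha y+\sum_{i=1}^N c_i(s_i)\quad\text{s.t.}\quad y+\sum_{i=1}^N s_i=\delta,\ s_i\ge0,\ y\ge0.$$ Supply function: $S(b_n,p)=\delta-\frac{b_n}{p}$. Clearing price: $p(\mathbf{b},y)=\frac{\sum_n b_n}{(N-1)\delta+y}$ (conventions $0/0=0$, $x/0=+\infty$ for $x>0$). Price-anticipating payoff (obtained with $p=\sqrt{(\sum_m b_m)\alpha/(N\delta)}$): for $\sum_m b_m>0$, $$Q_n(b_n;\mathbf{b}_{-n})=\sqrt{\frac{(\sum_m b_m)\alpha\delta}{N}}-b_n-c_n\!\left(\delta-\frac{b_n}{\sqrt{\sum_m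 b_m}}\sqrt{\frac{N\delta}{\alpha}}\right).$$ A price-anticipating market equilibrium is a triple $(\mathbf{b},p,y)$ with $\mathbf{b}\ge0$ such that $Q_n(b_n;\mathbf{b}_{-n})\ge Q_n(\bar b_n;\mathbf{b}_{-n})$ for all $n$ and all $\bar b_n\ge0$ for which this is defined; $p=p(\mathbf{b},y)$; and $y\in\arg\min_{0\le y'\le\delta}(\delta-y')p(\mathbf{b},y')+\alpha y'$. *)

(* Defs.v *)
From HB Require Import structures.
From mathcomp Require Import all_boot all_order all_algebra.
From mathcomp Require Import all_classical all_reals all_analysis.
Set Implicit Arguments.
Unset Strict Implicit.
Unset Printing Implicit Defensive.
Import Order.TTheory GRing.Theory Num.Theory.
Import numFieldNormedType.Exports.
Local Open Scope classical_set_scope.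
Local Open Scope ring_scope.

(* Since [lim] is total, the value is meaningful only when the limit exists in
   [R]; it always does at 0 for a function that is convex and nondecreasing on
   [0, +oo[. *)
Definition right_derive (R : realType) (f : R -> R) (x : R) : R :=
  lim (h^-1 * (f (x + h) - f x) @[h --> 0^'+]).

Definition social_cost (R : realType) (N : nat) (c : 'I_N -> R -> R) (alpha : R)
    (s : 'I_N -> R) (y : R) : R :=
  \sum_(n < N) c n (s n) + alpha * y.

Definition feasible (R : realType) (N : nat) (delta : R)
    (s : 'I_N -> R) (y : R) : Prop :=
  [/\ y + \sum_(n < N) s n = delta, forall n, 0 <= s n & 0 <= y].

Definition social_optimum (R : realType) (N : nat) (c : 'I_N -> R -> R)
    (alpha delta : R) (s : 'I_N -> R) (y : R) : Prop :=
  feasible delta s y /\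
  forall s' y', feasible delta s' y' ->
    social_cost c alpha s y <= social_cost c alpha s' y'.

(* Prices are extended reals: in [\bar R], [0 / 0 = 0 * +oo = 0] and
   [x / 0 = x * +oo = +oo] for [x > 0]. *)
Definition price (R : realType) (N : nat) (delta : R)
    (b : 'I_N -> R) (y : R) : \bar R :=
  ((\sum_(n < N) b n)%:E / ((N%:R - 1) * delta + y)%:E)%E.

Definition supply (R : realType) (delta b : R) (p : \bar R) : \bar R :=
  (delta%:E - b%:E / p)%E.

Definition total_bid (R : realType) (N : nat) (n : 'I_N) (x : R)
    (b : 'I_N -> R) : R :=
  x + \sum_(m < N | m != n) b m.

(* The payoff of [n] bidding [x] when the others bid as in [b] ([b n] is
   ignored); it is defined only when [0 < total_bid n x b]. *)
Definition payoff (R : realType) (N : nat) (c : 'I_N -> R -> R)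
    (alpha delta : R) (n : 'I_N) (x : R) (b : 'I_N -> R) : R :=
  let B := total_bid n x b in
  Num.sqrt (B * alpha * delta / N%:R) - x
  - c n (delta - x / Num.sqrt B * Num.sqrt (N%:R * delta / alpha)).

Definition operator_cost (R : realType) (N : nat) (alpha delta : R)
    (b : 'I_N -> R) (y : R) : \bar R :=
  ((delta - y)%:E * price delta b y + (alpha * y)%:E)%E.

(* Payoffs are undefined at the zero bid profile, so it is not an equilibrium;
   deviations range over the bids at which the payoff is defined. *)
Definition price_anticipating_equilibrium (R : realType) (N : nat)
    (c : 'I_N -> R -> R) (alpha delta : R)
    (b : 'I_N -> R) (p : \bar R) (y : R) : Prop :=
  [/\ (forall n, 0 <= b n) /\ 0 < \sum_(n < N) b n,
      forall n x, 0 <= x -> 0 < total_bid n x b ->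
        payoff c alpha delta n x b <= payoff c alpha delta n (b n) b,
      p = price delta b y,
      0 <= y <= delta
    & forall y', 0 <= y' <= delta ->
        (operator_cost alpha delta b y <= operator_cost alpha delta b y')%E].

(* Main.v *)
(* At an equilibrium with total bid B put u = sqrt (N delta B / alpha).
   Parametrising the bids of tenant n by v, where the total bid is
   alpha v^2 / (N delta), turns the supply into delta - v + A / v with A constant, and
   optimality of v = u makes
     g = (alpha / (N delta)) u^2 (2 u - delta) / (u^2 + A)
   a subgradient of c_n at the equilibrium supply s_n. If s_n > 0 then
   g < alpha, whereas y* > 0 makes every right marginal cost at s*_n at least
   alpha; hence s_n <= s*_n and the total supply sigma is below delta. So the
   operator's optimum is not at the corner y = 0, and the market price is the
   one assumed in the payoffs. Finally alpha - g <= 2 alpha sigma / (N delta),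
   so the excess cost is at most
     sum_n (alpha - g_n) (s*_n - s_n)
       <= 2 alpha sigma (delta - sigma) / (N delta) <= alpha delta / N. *)
Require Import Defs.
From HB Require Import structures.
From mathcomp Require Import all_boot all_order all_algebra.
From mathcomp Require Import all_classical all_reals all_analysis.
From mathcomp Require Import ring lra.
Import Order.TTheory GRing.Theory Num.Theory.
Import numFieldNormedType.Exports.
Local Open Scope classical_set_scope.
Local Open Scope ring_scope.

(** * First-order conditions for a convex cost *)

Lemma convex_chord (R : realType) (c : R -> R) (s t l : R) :
  convex_function (`[0, +oo[%classic : set R) c ->
  0 <= s -> 0 <= t -> 0 <= l -> l <= 1 ->
  c (s + l * (t - s)) - c s <= l * (c t - c s).
Proof.
move=> cconv s0 t0 l0 l1.
have ts : t \in (`[0, +oo[%classic : set R) by rewrite inE /= in_itv /= t0.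
have ss : s \in (`[0, +oo[%classic : set R) by rewrite inE /= in_itv /= s0.
have h : c (l * t + (1 - l) * s) <= l * c t + (1 - l) * c s.
  exact: (cconv (Itv01 l0 l1) t s ts ss).
have -> : s + l * (t - s) = l * t + (1 - l) * s by ring.
by lra.
Qed.

Lemma quadratic_at_right0_ge0 (R : realType) (a b d : R) :
  (\forall h \near 0^'+, 0 <= a + h * b + h ^+ 2 * d) -> 0 <= a.
Proof.
move=> H; pose p : {poly R} := a%:P + b%:P * 'X + d%:P * 'X^2.
have -> : a = p.[0] by rewrite /p !hornerE /=; ring.
have cp : p.[h] @[h --> 0^'+] --> p.[0].
  by apply: cvg_at_right_filter; exact: continuous_horner.
apply: (cvgr_to_ge cp); apply: filterS H => h; rewrite /p !hornerE /= => H.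
by rewrite (le_trans H) // le_eqVlt; apply/orP; left; apply/eqP; ring.
Qed.

(* Moving the bid so that [u] becomes [u + e h] moves the supply from [s]
   towards [t]; convexity bounds the cost increment by a fraction of
   [c t - c s], and [h] tends to [0]. *)
Lemma stationary_subgradient_dir (R : realType) (c : R -> R)
    (beta delta u A s t e : R) :
  convex_function (`[0, +oo[%classic : set R) c ->
  0 < u -> 0 <= A -> s = delta - u + A / u -> 0 <= s -> 0 <= t ->
  (forall v, 0 < v -> A <= v ^+ 2 ->
    beta * (v - u) * (delta - u - v) <= c (delta - v + A / v) - c s) ->
  e ^+ 2 = 1 -> 0 < e * (s - t) -> (\forall h \near 0^'+, A <= (u + e * h) ^+ 2) ->
  beta * u ^+ 2 * (2 * u - delta) * (t - s) <= (u ^+ 2 + A) * (c t - c s).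
Proof.
move=> cconv u0 A0 sE s0 t0 hbr e1 est nearA.
set K := c t - c s; set T := e * (s - t) in est *.
have tsE : t - s = - (e * T) by rewrite /T mulrA -expr2 e1; ring.
clearbody T.
rewrite -subr_ge0.
(* The coefficients come from expanding [(u * v + A) * K - beta * e * (delta - u - v) * u * v * T]
   at [v = u + e * h]. *)
apply: (@quadratic_at_right0_ge0 _ _
  (K * u * e - beta * T * u * (delta - 3 * u))
  (beta * T * u * e)).
have [e_le e_ge] : e <= 1 /\ - 1 <= e by split; nra.
have Au : 0 <= A / u ^+ 2 by rewrite divr_ge0 ?sqr_ge0.
near=> h.
have h0 : 0 < h by near: h; exact: nbhs_right_gt.
have hu : h < u / 2 by near: h; apply: nbhs_right_lt; lra.
have hT : h < T / (1 + 2 * (A / u ^+ 2)).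
  by near: h; apply: nbhs_right_lt; apply: divr_gt0 => //; lra.
have hA : A <= (u + e * h) ^+ 2 by near: h.
set v := u + e * h in hA.
have vu : u / 2 < v by rewrite /v; nra.
have v0 : 0 < v by lra.
(* The supply moves by [- e * h * (1 + A / (u * v))], which is the fraction [l] of
   [t - s = - e * T]; the bound [hT] gives [l <= 1]. *)
pose l := h * (1 + A / (u * v)) / T.
have Auv : A / (u * v) <= 2 * (A / u ^+ 2).
  rewrite ler_pdivrMr ?mulr_gt0 //.
  have -> : 2 * (A / u ^+ 2) * (u * v) = A * (2 * v / u) by field; lra.
  by rewrite ler_peMr // ler_pdivlMr //; lra.
have Auv0 : 0 <= A / (u * v) by rewrite divr_ge0 // ltW ?mulr_gt0.
have l0 : 0 <= l.
  by apply: divr_ge0; last exact: ltW; apply: mulr_ge0; [exact: ltW | lra].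
have l1 : l <= 1.
  rewrite /l ler_pdivrMr // mul1r.
  move: hT; rewrite ltr_pdivlMr; last lra.
  by nra.
have vE : delta - v + A / v = s + l * (t - s).
  rewrite tsE sE /l /v; field; rewrite -/v; repeat split; lra.
have := convex_chord _ _ _ _ _ cconv s0 t0 l0 l1.
have := hbr v v0 hA; rewrite vE -/K => h1 h2.
have {h1 h2} := le_trans h1 h2.
rewrite /l.
have -> : h * (1 + A / (u * v)) / T * K = h * ((u * v + A) * K) / (u * v * T).
  by field; lra.
rewrite ler_pdivlMr ?mulr_gt0 // => H.
have {}H : 0 <= h * ((u * v + A) * K - beta * e * (delta - u - v) * u * v * T).
  by rewrite -subr_ge0 in H; rewrite (le_trans H) // le_eqVlt; apply/orP; left; apply/eqP; rewrite /v; ring.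
move: H; rewrite pmulr_rge0 // => H.
rewrite (le_trans H) // le_eqVlt; apply/orP; left; apply/eqP.
rewrite tsE /v.
have [->|->] : e = 1 \/ e = -1.
  by move/eqP: (e1); rewrite sqrf_eq1 => /orP[]/eqP ->; [left | right].
all: ring.
Unshelve. all: by end_near. Qed.

(** The supply [delta - v + A / v] decreases in [v]. Reaching [t < s] means raising [v], which keeps
    [A <= v ^+ 2]; reaching [t > s] means lowering [v], which needs the slack [A < u ^+ 2]. *)
Lemma stationary_subgradient (R : realType) (c : R -> R)
    (beta delta u A s t : R) :
  convex_function (`[0, +oo[%classic : set R) c ->
  0 < u -> 0 <= A -> A <= u ^+ 2 -> s = delta - u + A / u -> 0 <= s -> 0 <= t ->
  (forall v, 0 < v -> A <= v ^+ 2 ->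
    beta * (v - u) * (delta - u - v) <= c (delta - v + A / v) - c s) ->
  (s < t -> A < u ^+ 2) ->
  beta * u ^+ 2 * (2 * u - delta) * (t - s) <= (u ^+ 2 + A) * (c t - c s).
Proof.
move=> cconv u0 A0 Au sE s0 t0 hbr stA.
have [st|ts|<-] := ltgtP s t; last by rewrite !subrr !mulr0.
- apply: (stationary_subgradient_dir _ _ _ _ _ _ _ _ (- 1)
    cconv u0 A0 sE s0 t0 hbr).
  + by rewrite sqrrN expr1n.
  + by lra.
  + near=> h.
    have h0 : 0 < h by near: h; exact: nbhs_right_gt.
    have : h < (u ^+ 2 - A) / (2 * u).
      near: h; apply: nbhs_right_lt; apply: divr_gt0; last by rewrite mulr_gt0.
      by rewrite subr_gt0 stA.
    by rewrite ltr_pdivlMr ?mulr_gt0 // => hu; nra.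
- apply: (stationary_subgradient_dir _ _ _ _ _ _ _ _ 1
    cconv u0 A0 sE s0 t0 hbr).
  + by rewrite expr1n.
  + by lra.
  + near=> h.
    have h0 : 0 < h by near: h; exact: nbhs_right_gt.
    by rewrite mul1r (le_trans Au) // ler_pXn2r ?nnegrE //; lra.
Unshelve. all: by end_near. Qed.

(** At a negative supply, a slightly lower bid would leave the supply nonpositive and the cost zero,
    while strictly raising the payoff. *)
Lemma stationary_supply_ge0 (R : realType) (c : R -> R) (beta delta u A s : R) :
  (forall x, x <= 0 -> c x = 0) -> 0 < beta -> 0 < delta ->
  0 < u -> 0 <= A -> s = delta - u + A / u ->
  (forall v, 0 < v -> A <= v ^+ 2 ->
    beta * (v - u) * (delta - u - v) <= c (delta - v + A / v) - c s) ->
  0 <= s.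
Proof.
move=> c0 beta0 delta0 u0 A0 sE hbr; rewrite leNgt; apply/negP => s0.
pose D := u ^+ 2 - delta * u - A.
have D0 : 0 < D.
  have : s * u < 0 by rewrite nmulr_rlt0.
  have -> : s * u = - D by rewrite sE /D; field; lra.
  by rewrite oppr_lt0.
have ud : delta < u by rewrite -(ltr_pM2r u0); rewrite /D in D0; nra.
(* This is [u + s / 2], a Newton step from [u] for [x ^+ 2 = delta * u + A]; it overshoots the root,
   so [v ^+ 2 >= delta * u + A > delta * v + A]. *)
pose v := u - D / (2 * u).
have vE : v * (2 * u) = u ^+ 2 + delta * u + A.
  by rewrite /v /D; field; lra.
have v0 : 0 < v.
  have : 0 < v * (2 * u).
    by rewrite vE; have := exprn_gt0 2 u0; have := mulr_gt0 delta0 u0; lra.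
  by rewrite pmulr_lgt0 // mulr_gt0.
have vu : v < u by rewrite /v ltrBlDr ltrDl divr_gt0 ?mulr_gt0.
have vA : delta * v + A <= v ^+ 2.
  have -> : v ^+ 2 = delta * v + A + (D / (2 * u)) ^+ 2 + delta * (D / (2 * u)).
    by rewrite /v /D; field; lra.
  have Du : 0 < D / (2 * u) by rewrite divr_gt0 ?mulr_gt0.
  have := sqr_ge0 (D / (2 * u)); have := mulr_gt0 delta0 Du; lra.
have Av : A <= v ^+ 2 by have := mulr_gt0 delta0 v0; lra.
have sv : delta - v + A / v <= 0.
  rewrite -(pmulr_lle0 _ v0).
  have -> : (delta - v + A / v) * v = delta * v + A - v ^+ 2 by field; lra.
  by rewrite subr_le0.
have := hbr v v0 Av; rewrite (c0 _ sv) (c0 _ (ltW s0)) subrr.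
rewrite leNgt => /negP; apply; rewrite nmulr_lgt0; last lra.
by rewrite pmulr_rlt0 // subr_lt0.
Qed.

(** * Payoffs and best responses in the variable [v] *)

Lemma payoff_reparam (R : realType) (N : nat) (c : 'I_N -> R -> R)
    (alpha delta v : R) (n : 'I_N) (b : 'I_N -> R)
    (k := N%:R * delta / alpha) (A := k * \sum_(m < N | m != n) b m) :
  (0 < N)%N -> 0 < delta -> 0 < alpha -> 0 < v ->
  total_bid n ((v ^+ 2 - A) / k) b = v ^+ 2 / k /\
  payoff c alpha delta n ((v ^+ 2 - A) / k) b =
    alpha * v / N%:R - (v ^+ 2 - A) / k - c n (delta - v + A / v).
Proof.
move=> N0 delta0 alpha0 v0.
have N0' : 0 < N%:R :> R by rewrite ltr0n.
have k0 : 0 < k by rewrite /k divr_gt0 ?mulr_gt0.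
have totE : total_bid n ((v ^+ 2 - A) / k) b = v ^+ 2 / k.
  by rewrite /total_bid /A; field; lra.
split=> //; rewrite /payoff totE -/k.
have -> : v ^+ 2 / k * alpha * delta / N%:R = (alpha * v / N%:R) ^+ 2.
  by rewrite /k; field; rewrite !gt_eqF.
have sk0 : 0 < Num.sqrt k by rewrite sqrtr_gt0.
have skE : Num.sqrt k ^+ 2 = k by rewrite sqr_sqrtr // ltW.
have -> : v ^+ 2 / k = (v / Num.sqrt k) ^+ 2 by rewrite expr_div_n skE.
rewrite !sqrtr_sqr !ger0_norm; [|by rewrite ltW ?divr_gt0 ?mulr_gt0..].
congr (_ - c n _).
have -> : (v ^+ 2 - A) / k / (v / Num.sqrt k) * Num.sqrt k =
    (v ^+ 2 - A) / k * Num.sqrt k ^+ 2 / v by field; rewrite !gt_eqF.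
by rewrite skE; field; rewrite !gt_eqF.
Qed.

(** As [1 / k = alpha / (N delta)], the change [alpha * (v - u) / N - (v ^+ 2 - u ^+ 2) / k] of the
    payoff without its cost term factors as the left-hand side. *)
Lemma best_response_increment (R : realType) (N : nat) (c : 'I_N -> R -> R)
    (alpha delta u A v : R) (n : 'I_N) (b : 'I_N -> R)
    (k := N%:R * delta / alpha) :
  (0 < N)%N -> 0 < delta -> 0 < alpha ->
  (forall x, 0 <= x -> 0 < total_bid n x b ->
    payoff c alpha delta n x b <= payoff c alpha delta n (b n) b) ->
  0 < u -> u ^+ 2 = k * \sum_(m < N) b m -> A = u ^+ 2 - k * b n ->
  0 < v -> A <= v ^+ 2 ->
  alpha / (N%:R * delta) * (v - u) * (delta - u - v) <=
    c n (delta - v + A / v) - c n (delta - u + A / u).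
Proof.
move=> N0 delta0 alpha0 hbr u0 uE AE v0 Av.
have N0' : 0 < N%:R :> R by rewrite ltr0n.
have k0 : 0 < k by rewrite /k divr_gt0 ?mulr_gt0.
have AE' : A = k * \sum_(m < N | m != n) b m.
  by rewrite AE uE (bigD1 n) //=; ring.
have bE : b n = (u ^+ 2 - A) / k by rewrite AE; field; rewrite gt_eqF.
have [_ pu] := payoff_reparam _ _ c _ _ _ n b N0 delta0 alpha0 u0.
have [tv pv] := payoff_reparam _ _ c _ _ _ n b N0 delta0 alpha0 v0.
rewrite -/k -AE' in pu tv pv; have := hbr ((v ^+ 2 - A) / k).
rewrite tv pv bE pu => /(_ _ _) h.
have {}h := h (divr_ge0 _ (ltW k0)) (divr_gt0 (exprn_gt0 _ v0) k0).
rewrite subr_ge0 in h; have {h} := h Av.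
rewrite -subr_ge0 => h; rewrite -subr_ge0 (le_trans h) // le_eqVlt.
by apply/orP; left; apply/eqP; rewrite /k; field; rewrite !gt_eqF.
Qed.

(** * Comparison with the social optimum *)

(** Shifting an amount [h <= y] from generation to tenant [n] cannot lower the social cost;
    convexity extends the resulting slope bound from [h] to [t - s n]. *)
Lemma optimal_marginal_cost (R : realType) (N : nat) (c : 'I_N -> R -> R)
    (alpha delta y t : R) (s : 'I_N -> R) (n : 'I_N) :
  convex_function (`[0, +oo[%classic : set R) (c n) ->
  social_optimum c alpha delta s y -> 0 < y -> s n <= t ->
  alpha * (t - s n) <= c n t - c n (s n).
Proof.
move=> cconv [[sumE s0 _] opt] y0; rewrite le_eqVlt => /predU1P[<-|st].
  by rewrite !subrr mulr0.
have T0 : 0 < t - s n by rewrite subr_gt0.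
pose h := Num.min (t - s n) y.
have h0 : 0 < h by rewrite lt_min T0 y0.
have hT : h <= t - s n by rewrite ge_min lexx.
have hy : h <= y by rewrite ge_min lexx orbT.
pose s' m := if m == n then s n + h else s m.
have sumE' (f : 'I_N -> R -> R) : \sum_(m < N) f m (s' m) =
    f n (s n + h) - f n (s n) + \sum_(m < N) f m (s m).
  rewrite (bigD1 n) //= [in RHS](bigD1 n) //= {1}/s' eqxx addrA subrK.
  by congr (_ + _); apply: eq_bigr => m /negPf mn; rewrite /s' mn.
have feas : feasible delta s' (y - h).
  split; last by lra.
  - by rewrite (sumE' (fun=> id)) -sumE; ring.
  - by move=> m; rewrite /s'; case: ifP => // _; have := s0 n; lra.
have := opt _ _ feas; rewrite /social_cost sumE' => ch.
have l0 : 0 <= h / (t - s n) by rewrite divr_ge0 ?ltW.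
have l1 : h / (t - s n) <= 1 by rewrite ler_pdivrMr // mul1r.
have := convex_chord _ _ _ _ _ cconv (s0 n) (le_trans (s0 n) (ltW st)) l0 l1.
rewrite divfK ?gt_eqF // => cc.
have {ch cc} : alpha * h <= h / (t - s n) * (c n t - c n (s n)) by lra.
rewrite mulrAC ler_pdivlMr // mulrAC [h * _]mulrC ler_pM2r //.
Qed.

(** If [t < s], the two slope bounds and [u ^+ 2 + A = u * (2 * u - delta + s)] give [alpha * (2 * u
    - delta + s) <= beta * u * (2 * u - delta)], impossible when [beta * u <= alpha] and [s > 0]. *)
Lemma stationary_supply_le (R : realType) (c : R -> R)
    (alpha beta delta u A s t : R) :
  0 < alpha -> 0 < beta -> beta * u <= alpha ->
  0 < u -> 0 <= A -> s = delta - u + A / u -> 0 <= t ->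
  (t < s -> beta * u ^+ 2 * (2 * u - delta) * (t - s)
     <= (u ^+ 2 + A) * (c t - c s)) ->
  (t < s -> alpha * (s - t) <= c s - c t) ->
  s <= t.
Proof.
move=> alpha0 beta0 bu u0 A0 sE t0 sub opt; rewrite leNgt; apply/negP => ts.
have {}sub := sub ts; have {}opt := opt ts.
have uA : 0 < u ^+ 2 + A by rewrite ltr_pwDl ?exprn_gt0.
have uAE : u ^+ 2 + A = u * (2 * u - delta + s) by rewrite sE; field; lra.
have w0 : 0 < 2 * u - delta + s by rewrite uAE pmulr_rgt0 in uA.
have := ler_wpM2l (ltW uA) opt => h.
have : (u * (2 * u - delta + s) * alpha) * (s - t)
    <= (beta * u ^+ 2 * (2 * u - delta)) * (s - t) by rewrite -uAE; lra.
rewrite ler_pM2r ?subr_gt0 //.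
have -> : u * (2 * u - delta + s) * alpha = u * (alpha * (2 * u - delta + s)).
  by ring.
have -> : beta * u ^+ 2 * (2 * u - delta) = u * (beta * u * (2 * u - delta)).
  by ring.
rewrite ler_pM2l // leNgt => /negP; apply.
have [d0|d0] := leP 0 (2 * u - delta).
  apply: le_lt_trans (ler_wpM2r d0 bu) _.
  by rewrite ltr_pM2l //; lra.
apply: (@lt_trans _ _ 0); last exact: mulr_gt0.
by rewrite pmulr_rlt0 // mulr_gt0.
Qed.

(** The bound depends on the tenants only through the total supply [sigma], so it can be factored
    out of a sum over them. *)
Lemma subgradient_deficit (R : realType) (alpha beta delta M u A s sigma : R) :
  0 < alpha -> beta = alpha / M -> 0 < M -> 0 < u -> 0 <= A ->
  s = delta - u + A / u -> u = M - sigma -> 0 <= s -> s <= sigma ->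
  alpha - beta * u ^+ 2 * (2 * u - delta) / (u ^+ 2 + A) <=
    2 * alpha * sigma / M.
Proof.
move=> alpha0 bE M0 u0 A0 sE uE s0 ss.
have uA : 0 < u ^+ 2 + A by rewrite ltr_pwDl ?exprn_gt0.
have ME : M = u + sigma by lra.
rewrite -subr_ge0.
have -> : 2 * alpha * sigma / M -
    (alpha - beta * u ^+ 2 * (2 * u - delta) / (u ^+ 2 + A)) =
    alpha * (u ^+ 2 * (sigma - s) + sigma * A) / (M * (u ^+ 2 + A)).
  by rewrite bE sE ME; field; rewrite -ME !gt_eqF.
apply: divr_ge0; apply: mulr_ge0; try exact: ltW.
by rewrite addr_ge0 // mulr_ge0 ?sqr_ge0 ?subr_ge0 // (le_trans s0).
Qed.

(** * The operator's choice of generation *)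

(** With [w = (N - 1) delta + y], the cost is [alpha * (u ^+ 2 / w + w)] up to a constant, with
    unique minimizer [w = u]; the bounds on [u] make this [y] admissible. *)
Lemma operator_choice_unique (R : realType) (N : nat) (alpha delta u y : R)
    (b : 'I_N -> R) :
  (0 < N)%N -> 0 < delta -> 0 < alpha -> 0 < \sum_(m < N) b m ->
  u ^+ 2 = N%:R * delta / alpha * \sum_(m < N) b m ->
  (N%:R - 1) * delta < u -> u <= N%:R * delta -> 0 <= y ->
  (forall y', 0 <= y' <= delta ->
    (operator_cost alpha delta b y <= operator_cost alpha delta b y')%E) ->
  y = u - (N%:R - 1) * delta.
Proof.
move=> N0 delta0 alpha0; set B := \sum_(m < N) b m => B0 uE Du uM y0 opt.
have N1 : 0 <= N%:R - 1 :> R by rewrite subr_ge0 ler1n.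
have N0' : 0 < N%:R :> R by rewrite ltr0n.
set D := (N%:R - 1) * delta in Du *.
have D0 : 0 <= D by rewrite mulr_ge0 // ltW.
have u0 : 0 < u by exact: le_lt_trans Du.
have costE z : D + z != 0 -> operator_cost alpha delta b z =
    ((delta - z) * (B / (D + z)) + alpha * z)%:E.
  by move=> Dz; rewrite /operator_cost /price -/B -/D inver (negPf Dz).
have DE : D = N%:R * delta - delta by rewrite /D; ring.
have Du0 : D + (u - D) != 0 by rewrite subrKC gt_eqF.
have uD : 0 <= u - D <= delta by apply/andP; split; lra.
have := opt _ uD; rewrite [X in (_ <= X)%E -> _]costE //.
(* A zero denominator means [N = 1] and [y = 0]: the price is then infinite, hence so is the
   cost. *)
have [Dy0|Dy0] := eqVneq (D + y) 0.
  have [D00 y00] : D = 0 /\ y = 0 by split; lra.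
  rewrite /operator_cost /price -/B -/D y00 D00 addr0 subr0 mulr0 adde0.
  rewrite inver eqxx.
  by rewrite gt0_muley ?lte_fin // gt0_muley ?lte_fin // leye_eq.
rewrite costE // lee_fin subrKC.
have Dy : 0 < D + y by rewrite lt_neqAle eq_sym Dy0 addr_ge0.
have ME : N%:R * delta = D + delta by lra.
have BE : B = alpha * u ^+ 2 / (D + delta).
  by rewrite uE -ME; field; rewrite !gt_eqF.
rewrite -subr_ge0.
have -> : (delta - (u - D)) * (B / u) + alpha * (u - D) -
    ((delta - y) * (B / (D + y)) + alpha * y) =
    - (alpha * (u - D - y) ^+ 2 / (D + y)).
  by rewrite BE; field; repeat split; rewrite gt_eqF //; lra.
rewrite oppr_ge0 pmulr_lle0 ?invr_gt0 // pmulr_rle0 // => sq.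
have : (u - D - y) ^+ 2 == 0 by rewrite eq_le sq sqr_ge0.
by rewrite sqrf_eq0 subr_eq0 => /eqP.
Qed.

(** * The welfare bound *)

Theorem theorem11 (R : realType) (N : nat) (delta alpha : R)
    (c : 'I_N -> R -> R)
    (hN : (1 <= N)%N) (hdelta : 0 < delta) (halpha : 0 < alpha)
    (hcont : forall n, continuous (c n))
    (hc0 : forall n s, s <= 0 -> c n s = 0)
    (hconv : forall n, convex_function (`[0, +oo[%classic : set R) (c n))
    (hincr : forall n, {in `[0, +oo[ &, {homo c n : s t / s < t}})
    (hderiv : forall n, alpha / (2 * N%:R) <= right_derive (c n) 0)
    (sstar : 'I_N -> R) (ystar : R)
    (hopt : social_optimum c alpha delta sstar ystar)
    (hystar : 0 < ystar)
    (ba : 'I_N -> R) (pa : \bar R) (ya : R)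
    (heq : price_anticipating_equilibrium c alpha delta ba pa ya)
    (sa : 'I_N -> R)
    (hsa : forall n, (sa n)%:E = supply delta (ba n) pa) :
  \sum_(n < N) c n (sa n) + alpha * ya
    <= \sum_(n < N) c n (sstar n) + alpha * ystar + alpha * delta / N%:R.
Proof.
have N0 : 0 < N%:R :> R by rewrite ltr0n.
case: heq => -[b0 B0] hbr paE /andP[ya0 _] hop.
set B := \sum_(n < N) ba n in B0.
pose k := N%:R * delta / alpha; pose u := Num.sqrt (k * B).
pose beta := alpha / (N%:R * delta).
pose A n := u ^+ 2 - k * ba n.
(* Supply at the price assumed in the payoffs; it is identified with [sa] only once [ya] is
   known. *)
pose s n := delta - u + A n / u.
have k0 : 0 < k by rewrite divr_gt0 ?mulr_gt0.
have M0 : 0 < N%:R * delta by rewrite mulr_gt0.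
have beta0 : 0 < beta by rewrite divr_gt0.
have u0 : 0 < u by rewrite sqrtr_gt0; exact: mulr_gt0.
have uE : u ^+ 2 = k * B by rewrite sqr_sqrtr // ltW //; exact: mulr_gt0.
have A0 n : 0 <= A n.
  rewrite /A uE subr_ge0 ler_pM2l // /B (bigD1 n) //= lerDl.
  by apply: sumr_ge0.
have Au n : A n <= u ^+ 2 by rewrite /A gerBl mulr_ge0 // ltW.
have incr n v : 0 < v -> A n <= v ^+ 2 ->
    beta * (v - u) * (delta - u - v) <= c n (delta - v + A n / v) - c n (s n).
  exact: (best_response_increment _ _ c _ _ u (A n) v n ba
    hN hdelta halpha (hbr n) u0 uE erefl).
have s0 n : 0 <= s n.
  exact: (stationary_supply_ge0 _ _ _ _ _ _ _
    (hc0 n) beta0 hdelta u0 (A0 n) erefl (incr n)).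
pose sigma := \sum_(n < N) s n.
have sE n : s n = delta - k * ba n / u by rewrite /s /A; field; rewrite gt_eqF.
have uS : u = N%:R * delta - sigma.
  rewrite /sigma (eq_bigr (fun n => delta - k / u * ba n)); last first.
    by move=> n _; rewrite sE; congr (_ - _); ring.
  rewrite sumrB sumr_const card_ord -mulr_sumr -/B mulrAC -uE -mulr_natl.
  by field; rewrite gt_eqF.
have sigma0 : 0 <= sigma by apply: sumr_ge0.
have [[sumE sstar0 _] _] := hopt.
(* Since [ystar > 0], this is strict; it supplies the slack [A n < u ^+ 2] when [s n < sstar n]. *)
have sstar_lt n : sstar n < delta.
  rewrite -sumE (bigD1 n) //=.
  have : 0 <= \sum_(m < N | m != n) sstar m by apply: sumr_ge0.
  by lra.
have sub n : beta * u ^+ 2 * (2 * u - delta) * (sstar n - s n) <=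
    (u ^+ 2 + A n) * (c n (sstar n) - c n (s n)).
  apply: (stationary_subgradient _ _ _ _ _ _ _ _
    (hconv n) u0 (A0 n) (Au n) erefl (s0 n) (sstar0 n) (incr n)) => st.
  have : A n / u < u by have := sstar_lt n; rewrite /s in st; lra.
  by rewrite ltr_pdivrMr // -expr2.
have sle n : s n <= sstar n.
  apply: (stationary_supply_le _ (c n) alpha beta delta u (A n)) => //.
  - by rewrite /beta mulrAC ler_pdivrMr // ler_pM2l //; lra.
  - move=> lt; exact: (optimal_marginal_cost _ _ _ _ _ _ _ _ _
      (hconv n) hopt hystar (ltW lt)).
have sigma_le : sigma <= delta - ystar.
  by rewrite -sumE addrAC subrr add0r; apply: ler_sum.
(* As [sigma <= delta - ystar < delta], [u] exceeds [(N - 1) delta], which excludes the corner. *)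
have yaE : ya = u - (N%:R - 1) * delta.
  apply: (operator_choice_unique _ _ _ _ _ _ _ hN hdelta halpha B0 uE) => //.
  - by lra.
  - by lra.
have saE n : sa n = s n.
  apply: EFin_inj; rewrite hsa paE /supply /price -/B yaE subrKC.
  rewrite inver gt_eqF // -EFinM inver gt_eqF ?divr_gt0 // -EFinM -EFinB sE.
  have BE : B = u ^+ 2 / k by rewrite uE; field; rewrite gt_eqF.
  by rewrite BE; congr (_ - _)%:E; field; rewrite !gt_eqF.
pose g n := beta * u ^+ 2 * (2 * u - delta) / (u ^+ 2 + A n).
have csub n : c n (s n) <= c n (sstar n) + g n * (s n - sstar n).
  have uA : 0 < u ^+ 2 + A n by rewrite ltr_pwDl ?exprn_gt0.
  have : g n * (sstar n - s n) <= c n (sstar n) - c n (s n).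
    by rewrite /g mulrAC ler_pdivrMr // mulrC [X in _ <= X]mulrC mulrC.
  by lra.
pose q := 2 * alpha * sigma / (N%:R * delta).
have gq n : alpha - g n <= q.
  apply: (subgradient_deficit _ _ _ _ _ u (A n) (s n)) => //.
  by rewrite /sigma (bigD1 n) //= lerDl sumr_ge0.
have sumc : \sum_(n < N) c n (s n) <=
    \sum_(n < N) c n (sstar n) + (alpha - q) * (sigma - (delta - ystar)).
  have -> : sigma - (delta - ystar) = \sum_(n < N) (s n - sstar n).
    rewrite sumrB -/sigma -sumE; ring.
  rewrite mulr_sumr -big_split /=; apply: ler_sum => n _.
  (* Here [s n - sstar n <= 0], so replacing [g n] by its lower bound [alpha - q] increases the
     product. *)
  apply: le_trans (csub n) _; rewrite lerD2l ler_wnM2r ?subr_le0 //.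
  by have := gq n; lra.
rewrite (eq_bigr (fun n => c n (s n))) => [|n _]; last by rewrite saE.
have qle : q * (delta - ystar - sigma) <= alpha * delta / N%:R.
  have q0 : 0 <= q by rewrite divr_ge0 ?mulr_ge0 // ltW.
  apply: (@le_trans _ _ (q * (delta - sigma))).
    by rewrite ler_wpM2l //; lra.
  rewrite /q mulrAC ler_pdivrMr // -subr_ge0.
  have -> : alpha * delta / N%:R * (N%:R * delta) -
      2 * alpha * sigma * (delta - sigma) =
      alpha * ((delta - sigma) ^+ 2 + sigma ^+ 2).
    by field; rewrite gt_eqF.
  by rewrite mulr_ge0 ?addr_ge0 ?sqr_ge0 // ltW.
have yaE' : ya = delta - sigma by lra.
by rewrite yaE'; lra.
Qed.
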